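(* Let $A=[a_{ij}]\in\mathbb{R}^{n\times n}$ be a nonnegative, irreducible, diagonally symmetrizable matrix with null diagonal, let $\delta_i=\sum_{j=1}^n a_{ij}$, $\Delta=\mathrm{diag}\{\delta_1,\dots,\delta_n\}$, let $\pi>0$ be a scalar parameter, $H_1=\Delta^{-1}A$ and $H=\pi H_1$. Consider the system $$\dot x=\Delta\left[-x+\pi H_1\psi(x)\right],\qquad x\in\mathbb{R}^n,$$ where $\psi(x)=[\psi_1(x_1)\,\cdots\,\psi_n(x_n)]^T$ and each nonlinear function $\psi_i:\mathbb{R}\to\mathbb{R}$ satisfies the properties (A.1)–(A.4) listed in the context. If the system admits an equilibrium point $\bar x\in\mathcal{K}$, where $\mathcal{K}$ is an orthant in $\mathbb{R}^n$ and $\mathcal{K}\neq\mathbb{R}^n_+,\mathbb{R}^n_-$, then there exists an eigenvalue $\lambda(H)$ of $H$ such that $\lambda(H)>1$ and $\lambda(H)\neq\rho(H)$.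
   Context: A matrix $A\in\mathbb{R}^{n\times n}$ is (diagonally) symmetrizable if $DA$ is symmetric for some diagonal matrix $D$ with positive diagonal entries; such a matrix has real eigenvalues. The matrix $H$ is symmetrizable too, so its eigenvalues are real. $\rho(H)$ denotes the spectral radius of $H$. Properties of each $\psi_i$: (A.1) $\psi_i(x_i)=-\psi_i(-x_i)$ for all $x_i\in\mathbb{R}$ (odd); (A.2) $\frac{\partial\psi_i}{\partial x_i}(x_i)>0$ for all $x_i\in\mathbb{R}$ and $\frac{\partial\psi_i}{\partial x_i}(0)=1$ (monotone); (A.3) $\lim_{x_i\to\pm\infty}\psi_i(x_i)=\pm1$ (saturated); (A.4) $\psi_i$ is strictly convex for $x_i<0$ and strictly concave for $x_i>0$ (sigmoidal). An orthant in $\mathbb{R}^n$ is a set $\mathcal{K}=\{x\in\mathbb{R}^n: k_ix_i\ge0,\ i=1,\dots,n\}$ with $k_i\in\{\pm1\}$; $\mathbb{R}^n_+$ and $\mathbb{R}^n_-$ are the orthants with all $k_i=1$ and all $k_i=-1$, respectively.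
   Formalization: The equilibrium point is assumed to be nonzero: the origin is always an equilibrium and lies in every orthant, so without this the claim fails (e.g. for small π, when all eigenvalues of H are below 1). *)

(* Defs.v *)
From HB Require Import structures.
From mathcomp Require Import all_boot all_order all_algebra perm.
From mathcomp Require Import all_classical all_reals all_analysis.
From mathcomp Require Import complex.

Set Implicit Arguments.
Unset Strict Implicit.
Unset Printing Implicit Defensive.

Import Order.TTheory GRing.Theory Num.Theory.
Import numFieldNormedType.Exports.

Local Open Scope classical_set_scope.
Local Open Scope ring_scope.

Section Matrices.
Variables (R : realType) (n : nat).
Implicit Types A : 'M[R]_n.

Definition nonneg_mx A : Prop := forall i j, 0 <= A i j.

Definition null_diagonal A : Prop := forall i, A i i = 0.

(* A is reducible when a simultaneous permutation of its rows and columns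
   brings it to block upper triangular form, the diagonal blocks being square
   of sizes k and n - k, both nonzero. *)
Definition reducible_mx A : Prop :=
  exists (s : 'S_n) (k : nat), (0 < k < n)%N /\
    forall i j : 'I_n, (k <= i)%N -> (j < k)%N ->
      (perm_mx s *m A *m (perm_mx s)^T) i j = 0.

Definition irreducible_mx A : Prop := ~ reducible_mx A.

Definition diag_symmetrizable A : Prop :=
  exists d : 'rV[R]_n,
    (forall i, 0 < d 0 i) /\ (diag_mx d *m A)^T = diag_mx d *m A.

(* Largest modulus of a complex eigenvalue; the set is finite, and nonempty
   as soon as 0 < n. The modulus in R[i] is itself an element of R[i], whence
   the projection to its real part. *)
Definition spectral_radius A : R :=
  sup [set complex.Re `|z| | z in
         [set z : complex R | eigenvalue (map_mx (real_complex R) A) z]].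

Definition degree_mx A : 'M[R]_n := diag_mx (\row_i \sum_j A i j).

(* [invmx] is a true inverse here only if all row sums of A are nonzero, as for
   a nonnegative irreducible A with 1 < n. *)
Definition normalized_mx A : 'M[R]_n := invmx (degree_mx A) *m A.

End Matrices.

Section Sigmoids.
Variable R : realType.
Implicit Types (f : R -> R) (D : set R).

Definition strictly_convex_on D f : Prop :=
  forall x y t : R, D x -> D y -> x != y -> 0 < t < 1 ->
    f (t * x + (1 - t) * y) < t * f x + (1 - t) * f y.

Definition strictly_concave_on D f : Prop :=
  forall x y t : R, D x -> D y -> x != y -> 0 < t < 1 ->
    t * f x + (1 - t) * f y < f (t * x + (1 - t) * y).

Definition odd_fct f : Prop := forall x, f x = - f (- x).

Definition monotone_fct f : Prop :=
  (forall x, derivable f x 1) /\ (forall x, 0 < derive1 f x) /\ derive1 f 0 = 1.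

Definition saturated_fct f : Prop :=
  (f x @[x --> +oo] --> (1 : R)) /\ (f x @[x --> -oo] --> (- 1 : R)).

Definition sigmoidal_fct f : Prop :=
  strictly_convex_on [set x | x < 0] f /\ strictly_concave_on [set x | 0 < x] f.

End Sigmoids.

Section System.
Variables (R : realType) (n : nat).

Definition orthant_of (k : 'I_n -> R) : set 'cV[R]_n :=
  [set x | forall i, 0 <= k i * x i 0].

Definition is_orthant (K : set 'cV[R]_n) : Prop :=
  exists k : 'I_n -> R, (forall i, k i = 1 \/ k i = - 1) /\ K = orthant_of k.

Definition pos_orthant : set 'cV[R]_n := orthant_of (fun=> 1).
Definition neg_orthant : set 'cV[R]_n := orthant_of (fun=> - 1).

(* Right-hand side of the system x' = Delta [- x + p H1 psi(x)]. *)
Definition vector_field (A : 'M[R]_n) (p : R) (psi : 'I_n -> R -> R)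
    (x : 'cV[R]_n) : 'cV[R]_n :=
  degree_mx A *m
    (- x + p *: (normalized_mx A *m \col_i psi i (x i 0))).

(* When all psi i are odd, 0 is an equilibrium of [vector_field A p psi] and
   lies in every orthant; statements about equilibria in a given orthant
   therefore have to exclude it explicitly. *)
Definition equilibrium (F : 'cV[R]_n -> 'cV[R]_n) (x : 'cV[R]_n) : Prop :=
  F x = 0.

End System.

Arguments pos_orthant {R n}.
Arguments neg_orthant {R n}.

(* Main.v *)
(* With f_i = sqrt (d_i delta_i), H is similar to the symmetric nonnegative
   irreducible matrix B = diag(f) H diag(f)^-1, and an equilibrium x gives
   t = diag(f) psi(x) with B t = diag(f) x. As |psi_i(s)| < |s| for s <> 0, one
   has t_i (B t)_i > t_i ^ 2 wherever t_i <> 0. If t had constant sign,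
   irreducibility would leave it no zero entry, and the orthant of x would be
   the positive or the negative one. So t has entries of both signs, and
   nonnegativity of the cross terms makes <v, B v> > <v, v> on the plane
   spanned by the positive and negative parts of t. Maximizing the Rayleigh
   quotient, first globally and then on the orthogonal of the resulting positive
   eigenvector u, yields eigenvalues lam1 > lam2 of B: lam2 > 1 because the
   plane meets the orthogonal of u, and lam2 <> lam1 because no eigenvector for
   lam1 has a zero entry. *)

Require Import Defs.
From HB Require Import structures.
From mathcomp Require Import all_boot all_order all_algebra perm.
From mathcomp Require Import all_classical all_reals all_analysis.
From mathcomp Require Import complex ring lra.
Set Implicit Arguments.
Unset Strict Implicit.
Unset Printing Implicit Defensive.
Import Order.TTheory GRing.Theory Num.Theory.
Import numFieldNormedType.Exports.
Local Open Scope classical_set_scope.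
Local Open Scope ring_scope.

(** * Inner product on row vectors and constrained Rayleigh maximization *)

Section Dot.
Variables (R : realType) (n : nat).
Implicit Types (u v w c : 'rV[R]_n) (B : 'M[R]_n).

Definition dot u v : R := (u *m v^T) 0 0.

Lemma dotE u v : dot u v = \sum_i u 0 i * v 0 i.
Proof. by rewrite /dot mxE; apply: eq_bigr => i _; rewrite mxE. Qed.

Lemma dotC u v : dot u v = dot v u.
Proof. by rewrite !dotE; apply: eq_bigr => i _; rewrite mulrC. Qed.

Lemma dotDl u v w : dot (u + v) w = dot u w + dot v w.
Proof. by rewrite /dot mulmxDl mxE. Qed.

Lemma dotZl a u v : dot (a *: u) v = a * dot u v.
Proof. by rewrite /dot -scalemxAl mxE. Qed.

Lemma dotNl u v : dot (- u) v = - dot u v.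
Proof. by rewrite /dot mulNmx mxE. Qed.

Lemma dotDr u v w : dot u (v + w) = dot u v + dot u w.
Proof. by rewrite dotC dotDl !(dotC u). Qed.

Lemma dotZr a u v : dot u (a *: v) = a * dot u v.
Proof. by rewrite dotC dotZl dotC. Qed.

Lemma dot0l u : dot 0 u = 0.
Proof. by rewrite /dot mul0mx mxE. Qed.

Lemma dot_ge0 u : 0 <= dot u u.
Proof. by rewrite dotE; apply: sumr_ge0 => i _; rewrite -expr2 sqr_ge0. Qed.

Lemma dot_eq0 u : (dot u u == 0) = (u == 0).
Proof.
apply/idP/eqP => [|->]; last by rewrite dot0l.
rewrite dotE psumr_eq0 => [/allP u0|i _]; last by rewrite -expr2 sqr_ge0.
apply/rowP => i; rewrite mxE; apply/eqP.
by have := u0 i (mem_index_enum i); rewrite /= mulf_eq0 orbb.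
Qed.

Lemma dot_gt0 u : (0 < dot u u) = (u != 0).
Proof. by rewrite lt0r dot_eq0 dot_ge0 andbT. Qed.

Lemma dot_mulmxl B u v : B^T = B -> dot (u *m B) v = dot u (v *m B).
Proof. by move=> Bs; rewrite /dot trmx_mul Bs mulmxA. Qed.

Lemma continuous_dot (f g : 'rV[R]_n -> 'rV[R]_n) :
  (forall i, continuous (fun v => f v 0 i)) ->
  (forall i, continuous (fun v => g v 0 i)) ->
  continuous (fun v => dot (f v) (g v)).
Proof.
move=> cf cg.
have -> : (fun v => dot (f v) (g v)) = (fun v => \sum_i f v 0 i * g v 0 i).
  by apply/funext => v; rewrite dotE.
apply: continuous_big => [|i _ v]; first exact: add_continuous.
by apply: (@cvgM _ _ (nbhs v)); [exact: cf|exact: cg].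
Qed.

Lemma continuous_mulmx_coord B i :
  continuous (fun v : 'rV[R]_n => (v *m B) 0 i).
Proof.
have -> : (fun v : 'rV[R]_n => (v *m B) 0 i) = (fun v => \sum_j v 0 j * B j i).
  by apply/funext => v; rewrite mxE.
apply: continuous_big => [|j _ v]; first exact: add_continuous.
by apply: (@cvgMl _ _ (nbhs v)); exact: coord_continuous.
Qed.

(** Taking [c = 0] gives the whole unit sphere, so the same set serves the global and the
    constrained maximization. *)
Lemma compact_sphere c :
  compact [set v : 'rV[R]_n | dot v v = 1 /\ dot v c = 0].
Proof.
apply: bounded_closed_compact.
  exists 1; split; first exact: num_real.
  move=> M M1 v /= [v1 _].
  rewrite [leLHS]/Num.norm /= mx_normrE.
  apply/bigmax_leP; split; first exact: le_trans (ltW M1).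
  move=> [i j] _ /=; apply: le_trans (ltW M1).
  rewrite (ord1 i) -(@ler_pXn2r _ 2) ?nnegrE// expr1n -v1 dotE (bigD1 j) //=.
  rewrite -normrX ger0_norm ?sqr_ge0 // -expr2 lerDl.
  by apply: sumr_ge0 => k _; rewrite -expr2 sqr_ge0.
rewrite (_ : mkset _ = (fun v => dot v v) @^-1` [set 1]
                  `&` (fun v => dot v c) @^-1` [set 0]); last by [].
have id_coord i : continuous (fun v : 'rV[R]_n => v 0 i).
  exact: coord_continuous.
apply: closedI; apply: preimage_closed.
- by move=> v _; exact: continuous_dot.
- exact: (@closed_eq R 1).
- by move=> v _; apply: (@continuous_dot id (fun=> c)) => // i;
  exact: cst_continuous.
- exact: (@closed_eq R 0).
Qed.

(* First variation of the maximizer along [w *m B - lam *: w]. *)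
Lemma rayleigh_critical B c mu lam w : B^T = B -> c *m B = mu *: c ->
  (forall v, dot v c = 0 -> dot (v *m B) v <= lam * dot v v) ->
  dot w c = 0 -> lam * dot w w <= dot (w *m B) w ->
  w *m B = lam *: w.
Proof.
move=> Bs cB ub wc wlam.
have [r rE] : exists r, r = w *m B - lam *: w by exists (w *m B - lam *: w).
(* As [B] is symmetric and [c] an eigenvector, the orthogonal of [c] is invariant, so [w + s *: r]
   remains admissible. *)
have rc : dot r c = 0.
  by rewrite rE -scaleNr dotDl dotZl dot_mulmxl // cB dotZr wc !mulr0 addr0.
pose q := dot (r *m B) r - lam * dot r r.
have qs s : 0 < s -> 2 * dot r r + s * q <= 0.
  move=> s0.
  have := ub (w + s *: r); rewrite dotDl dotZl wc rc mulr0 addr0 => /(_ erefl).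
  rewrite mulmxDl -scalemxAl !(dotDl, dotDr, dotZl, dotZr) (dotC r w).
  rewrite (dot_mulmxl r w Bs) (dotC r (w *m B)).
  have rrE : dot r r = dot (w *m B) r - lam * dot w r.
    by rewrite {1}rE -scaleNr dotDl dotZl mulNr.
  move=> h; rewrite -(ler_pM2l s0) mulr0 /q rrE; nra.
have r_ge0 := dot_ge0 r.
suff /eqP : dot r r = 0 by rewrite dot_eq0 rE subr_eq0 => /eqP.
apply/eqP; rewrite eq_le r_ge0 andbT leNgt; apply/negP => r_gt0.
(* With [s = dot r r / (1 + |q|)], [s |q| < dot r r], which contradicts [qs]. *)
have q1 : 0 < 1 + `|q| by rewrite ltr_pwDl.
have := qs (dot r r / (1 + `|q|)) (divr_gt0 r_gt0 q1).
have qN : - `|q| <= q by rewrite lerNl -normrN ler_norm.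
have : dot r r / (1 + `|q|) * (1 + `|q|) = dot r r by rewrite divfK ?gt_eqF.
have : 0 < dot r r / (1 + `|q|) by exact: divr_gt0.
by set s := dot r r / _; nra.
Qed.

(** The quotient attains its maximum on the compact unit sphere of the orthogonal of [c], which [z]
    shows to be nonempty. Homogeneity extends the bound to all vectors, and criticality makes the
    maximizer an eigenvector. *)
Lemma rayleigh_max B c mu z : B^T = B -> c *m B = mu *: c ->
  z != 0 -> dot z c = 0 ->
  exists lam w, [/\ w != 0, dot w c = 0, w *m B = lam *: w &
    forall v, dot v c = 0 -> dot (v *m B) v <= lam * dot v v].
Proof.
move=> Bs cB z0 zc.
have normalize v : v != 0 -> dot v c = 0 ->
    let s := (Num.sqrt (dot v v))^-1 in
    dot (s *: v) (s *: v) = 1 /\ dot (s *: v) c = 0.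
  move=> v0 vc s; rewrite !(dotZl, dotZr) vc mulr0 mulrA -expr2 exprVn.
  by rewrite sqr_sqrtr ?dot_ge0 // mulVf // dot_eq0.
have [w] := @EVT_max_rV R n (fun v => dot (v *m B) v) _
  (ex_intro _ _ (normalize z z0 zc)) (compact_sphere (c := c))
  (continuous_subspaceT (continuous_dot (fun i => @continuous_mulmx_coord B i)
    (fun i => @coord_continuous _ _ _ 0 i))).
rewrite inE => -[/= w1 wc] wmax.
have ub v : dot v c = 0 -> dot (v *m B) v <= dot (w *m B) w * dot v v.
  have [->|v0 vc] := eqVneq v 0; first by rewrite mul0mx !dot0l mulr0.
  have v1 := normalize v v0 vc.
  have := wmax _ (mem_set v1).
  rewrite -scalemxAl dotZl dotZr mulrA -expr2 exprVn sqr_sqrtr ?dot_ge0 //.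
  by rewrite mulrC ler_pdivrMr ?dot_gt0.
exists (dot (w *m B) w), w; split => //.
  by rewrite -dot_eq0 w1 oner_eq0.
by apply: (rayleigh_critical Bs cB ub) => //; rewrite w1 mulr1.
Qed.

End Dot.

(** * Irreducibility as connectivity, positivity, and two eigenvalues above 1 *)

Section Irreducible.
Variables (R : realType) (n : nat).
Implicit Types (A B : 'M[R]_n) (t u w : 'rV[R]_n).

(** Strong connectivity of the digraph of nonzero entries, stated through cuts so that later
    arguments avoid permutations. *)
Definition connected_mx A := forall I : pred 'I_n,
  (exists i, I i) -> (exists j, ~~ I j) ->
  exists i j, [/\ I i, ~~ I j & A i j != 0].

(** If no edge leaves [I], listing the indices outside [I] first and those of [I] last produces the
    zero block of a reducible matrix. *)
Lemma irreducible_connected A : irreducible_mx A -> connected_mx A.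
Proof.
move=> irrA I [i0 Ii0] [j0 Ij0]; apply: contrapT => noedge; apply: irrA.
pose sN := [seq i <- enum 'I_n | ~~ I i]; pose sI := [seq i <- enum 'I_n | I i].
have szs : size (sN ++ sI) = n.
  by rewrite size_cat !size_filter addnC count_predC size_enum_ord.
have s_uniq : uniq (sN ++ sI).
  rewrite cat_uniq !(filter_uniq _ (enum_uniq _)) andbT /=.
  by apply/hasPn => i; rewrite !mem_filter negb_and => /andP[->].
(* The default [i] is never reached, since the list has length [n]. *)
have f_inj : injective (fun i : 'I_n => nth i (sN ++ sI) i).
  move=> i j /=; rewrite (set_nth_default j) ?szs // => /eqP.
  by rewrite nth_uniq ?szs // => /eqP /val_inj.
exists (perm f_inj), (size sN); split.
  have sN_gt0 : (0 < size sN)%N.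
    by rewrite size_filter -has_count; apply/hasP; exists j0; rewrite ?mem_enum.
  have sI_gt0 : (0 < size sI)%N.
    by rewrite size_filter -has_count; apply/hasP; exists i0; rewrite ?mem_enum.
  by rewrite sN_gt0 -[ltnRHS]szs size_cat -[ltnLHS]addn0 ltn_add2l.
move=> i j ki jk.
rewrite tr_perm_mx -row_permE -col_permE !mxE !permE.
apply/eqP/negPn/negP => Aij; apply: noedge.
exists (nth i (sN ++ sI) i), (nth j (sN ++ sI) j); split => //.
- rewrite nth_cat ltnNge ki /=.
  have : nth i sI (i - size sN) \in sI.
    by rewrite mem_nth // ltn_subLR // -size_cat szs.
  by rewrite mem_filter => /andP[].
- rewrite nth_cat jk.
  by have := mem_nth j jk; rewrite mem_filter => /andP[].
Qed.

(** Otherwise an edge from the support of [t] to a zero [k] of [t] would make entry [k] of [t *m A]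
    positive. *)
Lemma connected_pos A t : nonneg_mx A -> connected_mx A ->
  (forall i, 0 <= t 0 i) -> t != 0 ->
  (forall i, t 0 i = 0 -> (t *m A) 0 i = 0) -> forall i, 0 < t 0 i.
Proof.
move=> A_ge0 Aconn t_ge0 t_neq0 tA0 i; rewrite lt0r t_ge0 andbT.
apply/negP => /eqP ti.
have [||j [k [/= tj /negPn /eqP tk Ajk]]] := Aconn [pred j | t 0 j != 0].
- apply: contrapT => t0; move/negP: t_neq0; apply; apply/eqP/rowP => j.
  by rewrite mxE; apply/eqP/negPn/negP => tj; apply: t0; exists j.
- by exists i; rewrite /= ti eqxx.
have := tA0 k tk; rewrite mxE => /eqP; rewrite psumr_eq0 => [|l _].
  move=> /allP /(_ j (mem_index_enum j)) /=.
  by rewrite mulf_eq0 (negPf tj) (negPf Ajk).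
by rewrite mulr_ge0.
Qed.

Section Perron.
Variables (B : 'M[R]_n) (lam : R).
Hypotheses (B_sym : B^T = B) (B_ge0 : nonneg_mx B) (B_conn : connected_mx B)
  (lam_ub : forall v, dot (v *m B) v <= lam * dot v v).

(* Taking absolute values can only increase the Rayleigh quotient, so the
   modulus of a maximizer is again a maximizer. *)
Lemma max_eigenvector_abs w : w *m B = lam *: w ->
  map_mx Num.norm w *m B = lam *: map_mx Num.norm w.
Proof.
move=> wB; apply: (@rayleigh_critical _ _ B 0 0) => //.
- by rewrite mul0mx scaler0.
- by rewrite dotC dot0l.
have -> : dot (map_mx Num.norm w) (map_mx Num.norm w) = dot w w.
  rewrite !dotE; apply: eq_bigr => i _.
  by rewrite !mxE -expr2 real_normK ?num_real.
rewrite -dotZl -wB !dotE; apply: ler_sum => i _.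
rewrite !mxE !mulr_suml; apply: ler_sum => j _; rewrite !mxE.
apply: le_trans (ler_norm _) _; rewrite !normrM.
by rewrite [`|B j i|]ger0_norm.
Qed.

(** The modulus of [w] is an eigenvector too, so wherever it vanishes its image under [B] vanishes,
    and connectivity applies. *)
Lemma max_eigenvector_neq0 w : w *m B = lam *: w -> w != 0 ->
  forall i, 0 < map_mx Num.norm w 0 i.
Proof.
move=> wB w0; apply: (connected_pos B_ge0 B_conn).
- by move=> i; rewrite mxE.
- apply: contra_neq w0 => w0; apply/rowP => i.
  by have /rowP/(_ i) := w0; rewrite !mxE => /eqP; rewrite normr_eq0 => /eqP.
- by move=> i wi; rewrite max_eigenvector_abs // mxE wi mulr0.
Qed.

End Perron.

Definition pos_part t : 'rV[R]_n := \row_i Num.max (t 0 i) 0.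

Lemma pos_part_ge0 t i : 0 <= pos_part t 0 i.
Proof. by rewrite mxE le_max lexx orbT. Qed.

(** The hypothesis is summed over the positive entries of [t]; the other terms are zero, and [i0]
    makes the sum strict. *)
Lemma dot_pos_part_lt t (x : 'rV[R]_n) i0 : 0 < t 0 i0 ->
  (forall i, t 0 i != 0 -> t 0 i ^+ 2 < t 0 i * x 0 i) ->
  dot (pos_part t) (pos_part t) < dot x (pos_part t).
Proof.
move=> ti0 tx.
have lt i : 0 < t 0 i ->
    pos_part t 0 i * pos_part t 0 i < x 0 i * pos_part t 0 i.
  move=> ti; rewrite !mxE max_l ?(ltW ti) // -expr2 [ltRHS]mulrC.
  by apply: tx; rewrite gt_eqF.
rewrite !dotE (bigD1 i0) //= [ltRHS](bigD1 i0) //=.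
apply: ltr_leD; first exact: lt.
apply: ler_sum => i _; have [ti|ti] := leP (t 0 i) 0.
  by rewrite !mxE max_r // !mulr0.
exact/ltW/lt.
Qed.

Lemma pos_part_gt0 t i : 0 < t 0 i -> 0 < pos_part t 0 i.
Proof. by move=> ti; rewrite mxE lt_max ti. Qed.

Lemma dot_gt0_pos t u i : (forall j, 0 <= t 0 j) -> 0 < t 0 i ->
  (forall j, 0 < u 0 j) -> 0 < dot t u.
Proof.
move=> t_ge0 ti u_gt0; rewrite dotE (bigD1 i) //= ltr_pwDl //.
  by rewrite mulr_gt0.
by apply: sumr_ge0 => j _; rewrite mulr_ge0 // ltW.
Qed.

Lemma pos_partB t : t = pos_part t - pos_part (- t).
Proof.
apply/rowP => i; rewrite !mxE.
by have [ti|ti] := leP (t 0 i) 0; have [ti'|ti'] := leP (- t 0 i) 0; lra.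
Qed.

Lemma dot_pos_partN t : dot (pos_part t) (pos_part (- t)) = 0.
Proof.
rewrite dotE big1 // => i _; rewrite !mxE.
by have [ti|ti] := leP (t 0 i) 0; have [ti'|ti'] := leP (- t 0 i) 0; nra.
Qed.

Lemma two_eigenvalues_gt1 B t i0 j0 :
  B^T = B -> nonneg_mx B -> connected_mx B ->
  0 < t 0 i0 -> t 0 j0 < 0 ->
  (forall i, t 0 i != 0 -> t 0 i ^+ 2 < t 0 i * (t *m B) 0 i) ->
  exists lam1 lam2, [/\ eigenvalue B lam1, eigenvalue B lam2,
    1 < lam2 & lam2 < lam1].
Proof.
move=> Bs B_ge0 Bconn ti0 tj0 tB.
have dotv0 (v : 'rV[R]_n) : dot v 0 = 0 by rewrite dotC dot0l.
have t_neq0 : t != 0 by apply: contraTneq ti0 => ->; rewrite mxE ltxx.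
(* With [c = 0] the orthogonality constraint is void: this is the global maximum. *)
have [||l1 [w [w_neq0 _ wB ub1']]] := @rayleigh_max _ _ B 0 0 t Bs _ t_neq0 _.
- by rewrite mul0mx scaler0.
- exact: dotv0.
have ub1 v : dot (v *m B) v <= l1 * dot v v by exact: ub1'.
have u_gt0 := max_eigenvector_neq0 Bs B_ge0 Bconn ub1 wB w_neq0.
have uB := max_eigenvector_abs Bs B_ge0 ub1 wB.
move: (map_mx Num.norm w) u_gt0 uB => u u_gt0 uB.
set tp := pos_part t; set tm := pos_part (- t).
have tE : t = tp - tm by exact: pos_partB.
have ltp : dot tp tp < dot (t *m B) tp by exact: dot_pos_part_lt ti0 tB.
have ltm : dot tm tm < dot (- (t *m B)) tm.
  apply: (@dot_pos_part_lt _ _ j0); first by rewrite mxE oppr_gt0.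
  by move=> i; rewrite !mxE oppr_eq0 sqrrN mulrNN => /tB; rewrite mxE.
have a_gt0 : 0 < dot tm u.
  apply: (@dot_gt0_pos _ _ j0) => //; first exact: pos_part_ge0.
  by apply: pos_part_gt0; rewrite mxE oppr_gt0.
have b_gt0 : 0 < dot tp u.
  by apply: (@dot_gt0_pos _ _ i0) => //;
    [exact: pos_part_ge0|exact: pos_part_gt0].
have G_ge0 : 0 <= dot (tp *m B) tm.
  rewrite dotE; apply: sumr_ge0 => i _; rewrite mulr_ge0 ?pos_part_ge0 //.
  by rewrite mxE; apply: sumr_ge0 => j _; rewrite mulr_ge0 ?pos_part_ge0.
have tpm : dot tp tm = 0 by exact: dot_pos_partN.
clearbody tp tm; subst t.
move: a_gt0 b_gt0; set a := dot tm u; set b := dot tp u => a_gt0 b_gt0.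
(* The weights [a = dot tm u] and [b = dot tp u] are those that make the combination orthogonal to
   [u]. *)
have zu : dot (a *: tp + (- b) *: tm) u = 0.
  by rewrite dotDl !dotZl -/a -/b; lra.
have zB : dot (a *: tp + (- b) *: tm) (a *: tp + (- b) *: tm) <
    dot ((a *: tp + (- b) *: tm) *m B) (a *: tp + (- b) *: tm).
  move: ltp ltm; rewrite !mulmxDl !mulNmx -!scalemxAl.
  rewrite !(dotNl, dotDl, dotDr, dotZl, dotZr) (dotC tm tp) tpm.
  rewrite (dot_mulmxl tm tp Bs) (dotC tm (tp *m B)).
  move: a b a_gt0 b_gt0 {zu} => a b a_gt0 b_gt0.
  set P := dot (tp *m B) tp; set M := dot (tm *m B) tm.
  set G := dot (tp *m B) tm in G_ge0 *.
  set p := dot tp tp; set m := dot tm tm => ltp ltm.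
  (* Here [p < P - G] and [m < M - G]. Weighting by the squares of [a] and [b] subtracts
     [(a ^+ 2 + b ^+ 2) * G] where only [2 * a * b * G] is wanted; [h3] absorbs the difference. *)
  have h1 : a ^+ 2 * p < a ^+ 2 * (P - G).
    by rewrite ltr_pM2l ?exprn_gt0 //; lra.
  have h2 : b ^+ 2 * m < b ^+ 2 * (M - G).
    by rewrite ltr_pM2l ?exprn_gt0 //; lra.
  have h3 : 0 <= (a - b) ^+ 2 * G by rewrite mulr_ge0 ?sqr_ge0.
  lra.
move: zu zB; move: (a *: tp + (- b) *: tm) => z zu zB.
have z_neq0 : z != 0 by apply: contraTneq zB => ->; rewrite mul0mx ltxx.
have [l2 [v [v_neq0 vu vB ub2]]] := rayleigh_max Bs uB z_neq0 zu.
exists l1, l2; split.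
- by apply/eigenvalueP; exists w.
- by apply/eigenvalueP; exists v.
- have := lt_le_trans zB (ub2 z zu).
  by rewrite -[ltLHS]mul1r ltr_pM2r // dot_gt0.
rewrite lt_neqAle; apply/andP; split; last first.
  by have := ub1 v; rewrite vB dotZl ler_pM2r // dot_gt0.
apply/eqP => l21; rewrite l21 in vB.
(* If [l2 = l1], then [v - k u] satisfies the eigenvector equation for [l1] and vanishes at [i0],
   hence is zero; but [v] is nonzero and orthogonal to [u]. *)
pose k := v 0 i0 / u 0 i0.
have : v + (- k) *: u == 0.
  apply/negPn/negP => vk.
  have := @max_eigenvector_neq0 _ _ Bs B_ge0 Bconn ub1 (v + (- k) *: u) _ vk i0.
  rewrite !mxE /k mulNr divfK ?gt_eqF // subrr normr0 ltxx.
  suff -> : (v + - (v 0 i0 / u 0 i0) *: u) *m B =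
      l1 *: (v + - (v 0 i0 / u 0 i0) *: u)
    by move/(_ erefl).
  by rewrite mulmxDl -scalemxAl vB uB scalerDr !scalerA mulrC.
rewrite scaleNr subr_eq0 => /eqP vk.
move/eqP: vu; rewrite vk dotZl mulf_eq0 dot_eq0 => /orP[/eqP k0|/eqP u0].
  by rewrite vk k0 scale0r eqxx in v_neq0.
by have := u_gt0 i0; rewrite u0 mxE ltxx.
Qed.

End Irreducible.

(** * Comparison of a sigmoid with the identity *)

Section Sigmoid.
Variables (R : realType) (f : R -> R).
Hypotheses (f_odd : odd_fct f) (f_mono : monotone_fct f)
  (f_sig : sigmoidal_fct f).

Lemma odd_fct0 : f 0 = 0.
Proof. by have := f_odd 0; rewrite oppr0; lra. Qed.

Lemma monotone_fct_gt0 x : 0 < x -> 0 < f x.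
Proof.
move=> x0; have [df [f'_gt0 _]] := f_mono.
have [||c _] := @MVT R f (derive1 f) 0 x x0.
- by move=> y _; rewrite derive1E; apply: DeriveDef.
- apply: continuous_subspaceT => y.
  by apply/differentiable_continuous/derivable1_diffP.
by rewrite odd_fct0 !subr0 => ->; rewrite mulr_gt0.
Qed.

(** Concavity is assumed only on the open half-line, so the chord from the origin is the limit of
    chords from [e > 0]; strictness is lost in the limit. *)
Lemma sigmoid_chord x t : 0 < x -> 0 < t < 1 -> t * f x <= f (t * x).
Proof.
move=> x0 t01; have [df _] := f_mono; have [_ f_conc] := f_sig.
have f_cont y : {for y, continuous f}.
  by apply/differentiable_continuous/derivable1_diffP.
have lim1 : (f (t * x + (1 - t) * e) - (1 - t) * f e) @[e --> 0^'+] -->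
    f (t * x + (1 - t) * 0) - (1 - t) * f 0.
  apply: cvg_at_right_filter; apply: cvgB; last first.
    by apply: cvgMr; exact: f_cont.
  apply: (@continuous_comp _ _ _ (fun e => t * x + (1 - t) * e) f).
    by apply: cvgD; [exact: cvg_cst|apply: cvgMr; exact: cvg_id].
  exact: f_cont.
rewrite mulr0 addr0 odd_fct0 mulr0 subr0 in lim1.
rewrite -(cvg_lim _ lim1) //; apply: limr_ge.
  by apply/cvg_ex; exists (f (t * x)).
near=> e; rewrite lerBrDr; apply/ltW/f_conc => //=.
by rewrite gt_eqF.
Unshelve. all: by end_near.
Qed.

(** By the chord inequality with [t = h / x], [f x / x] is at most [f h / h], which tends to the
    slope 1 at the origin. *)
Lemma sigmoid_le x : 0 < x -> f x <= x.
Proof.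
move=> x0; have [df [_ f'0]] := f_mono.
have lim2 : (h^-1 * f h) @[h --> 0^'+] --> (1 : R).
  have := cvg_dnbhs_at_right (df 0).
  rewrite -[X in _ --> X]/('D_1 f 0) -derive1E f'0 odd_fct0.
  rewrite [X in fmap X _](_ : _ = (fun h => h^-1 * f h)) //.
  by apply/funext => h /=; rewrite subr0 addr0 /GRing.scale /= mulr1.
rewrite -[leRHS]mul1r -ler_pdivrMr // -(cvg_lim _ lim2) //.
apply: limr_ge; first by apply/cvg_ex; exists 1.
near=> h; rewrite ler_pdivlMl // mulrC mulrAC -mulrA mulrC.
have := @sigmoid_chord x (h / x); rewrite divfK ?gt_eqF //; apply => //.
apply/andP; split; first exact: divr_gt0.
by rewrite ltr_pdivrMr // mul1r.
Unshelve. all: by end_near.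
Qed.

Lemma sigmoid_lt x : 0 < x -> f x < x.
Proof.
move=> x0; rewrite lt_neqAle sigmoid_le // andbT.
apply/eqP => fx; have [_ f_conc] := f_sig.
have half_t : 0 < (2^-1 : R) < 1 by apply/andP; split; lra.
(* [f] would be on or above the diagonal at [x / 2], hence strictly above it
   at [3 x / 4]. *)
have := sigmoid_chord x0 half_t; rewrite fx => fh.
have x4 : 0 < 2^-1 * x + (1 - 2^-1) * (2^-1 * x) by lra.
have := sigmoid_le x4.
have := f_conc x (2^-1 * x) 2^-1 x0.
have h0 : 0 < 2^-1 * x by lra.
have hx : x != 2^-1 * x by apply/eqP; lra.
by move=> /(_ h0 hx half_t); rewrite fx; lra.
Qed.

(** The factor [f x] makes both sides even in [x], which reduces the claim to [x > 0]. *)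
Lemma sigmoid_sqr_lt x : x != 0 -> f x ^+ 2 < f x * x.
Proof.
have pos y : 0 < y -> f y ^+ 2 < f y * y.
  move=> y0; rewrite expr2 ltr_pM2l ?sigmoid_lt //.
  exact: monotone_fct_gt0.
have [x0 _|x0 _|//] := ltgtP x 0; last exact: pos.
by rewrite f_odd sqrrN mulNr -mulrN; apply: pos; rewrite oppr_gt0.
Qed.

Lemma sigmoid_le0 x : x <= 0 -> f x <= 0.
Proof.
rewrite le_eqVlt => /orP[/eqP->|x0]; first by rewrite odd_fct0.
by rewrite f_odd oppr_le0 ltW // monotone_fct_gt0 // oppr_gt0.
Qed.

Lemma sigmoid_ge0 x : 0 <= x -> 0 <= f x.
Proof. by move=> x0; rewrite f_odd oppr_ge0 sigmoid_le0 // oppr_le0. Qed.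

Lemma sigmoid_eq0 x : f x = 0 -> x = 0.
Proof.
move=> fx; apply/eqP/negPn/negP => /sigmoid_sqr_lt.
by rewrite fx expr2 !mul0r ltxx.
Qed.

End Sigmoid.

(** * Spectral radius, diagonal similarity and row sums *)

Section Spectral.
Variables (R : realType) (n : nat).
Implicit Types (A B H : 'M[R]_n).

(** Crude bound from the 1-norm of a left eigenvector; it shows that the set under [sup] in
    [spectral_radius] is bounded above. *)
Lemma eigenvalue_complex_le H (z : complex R) :
  eigenvalue (map_mx (real_complex R) H) z ->
  complex.Re `|z| <= \sum_i \sum_j `|H i j|.
Proof.
set c := \sum_i _ => /eigenvalueP[v vH v0].
suff : `|z| <= real_complex R c by rewrite lecE => /andP[].
have v_gt0 : 0 < \sum_j `|v 0 j|.
  rewrite lt0r sumr_ge0 // andbT; apply: contra v0.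
  rewrite psumr_eq0 // => /allP v0; apply/eqP/rowP => i; rewrite mxE.
  by apply/eqP; rewrite -normr_eq0; exact: v0 (mem_index_enum i).
have nC (x : R) : `|real_complex R x| = real_complex R `|x|.
  by rewrite normc_def /= expr0n /= addr0 sqrtr_sqr.
rewrite -(ler_pM2r v_gt0) mulr_sumr mulr_sumr.
apply: (@le_trans _ _ (\sum_j \sum_i `|v 0 i| * real_complex R `|H i j|)).
  apply: ler_sum => j _.
  have /rowP/(_ j) := vH; rewrite !mxE -normrM => <-.
  apply: le_trans (ler_norm_sum _ _ _) _; apply: ler_sum => i _.
  by rewrite mxE normrM nC.
rewrite exchange_big /=; apply: ler_sum => i _.
rewrite -mulr_sumr mulrC -rmorph_sum ler_wpM2r // lecR.
rewrite /c [leRHS](bigD1 i) //= lerDl.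
by apply: sumr_ge0 => k _; apply: sumr_ge0.
Qed.

Lemma le_spectral_radius H lam : eigenvalue H lam -> lam <= spectral_radius H.
Proof.
move=> Hlam.
apply: (@le_trans _ _ (complex.Re `|real_complex R lam|)).
  have : real_complex R lam <= `|real_complex R lam|.
    by apply: real_ler_norm; rewrite complex_real.
  by rewrite lecE => /andP[].
apply: ub_le_sup; first last.
  by exists (real_complex R lam) => //=; rewrite eigenvalue_map.
exists (\sum_i \sum_j `|H i j|) => _ [z zH <-].
exact: eigenvalue_complex_le.
Qed.

(** The second hypothesis reads [diag(f) H = B diag(f)], so [w diag(f)] is a left eigenvector of [H]
    whenever [w] is one of [B]. *)
Lemma eigenvalue_diag_similar H B (f : 'I_n -> R) lam :
  (forall i, f i != 0) -> (forall i j, f i * H i j = B i j * f j) ->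
  eigenvalue B lam -> eigenvalue H lam.
Proof.
move=> f0 fH /eigenvalueP[w wB w0]; apply/eigenvalueP.
exists (\row_i (w 0 i * f i)).
  apply/rowP => j; rewrite !mxE mulrA.
  have /rowP/(_ j) := wB; rewrite !mxE => <-.
  by rewrite mulr_suml; apply: eq_bigr => i _; rewrite mxE -!mulrA fH.
apply: contra w0 => /eqP/rowP wf; apply/eqP/rowP => i.
by have /eqP := wf i; rewrite !mxE mulf_eq0 (negPf (f0 i)) orbF => /eqP.
Qed.

Lemma degree_mx_unit A : (forall i, 0 < \sum_j A i j) ->
  degree_mx A \in unitmx.
Proof.
move=> dA; rewrite unitmxE det_diag unitfE; apply/prodf_neq0 => i _.
by rewrite mxE gt_eqF.
Qed.

Lemma normalized_mxE A i j : (forall i, 0 < \sum_j A i j) ->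
  normalized_mx A i j = A i j / \sum_k A i k.
Proof.
move=> dA; rewrite /normalized_mx.
have {2}-> : A = degree_mx A *m \matrix_(i, j) (A i j / \sum_k A i k).
  apply/matrixP => k l; rewrite mul_diag_mx !mxE.
  by rewrite mulrC divfK // gt_eqF.
by rewrite mulKmx ?degree_mx_unit // mxE.
Qed.

(** An edge leaves the singleton of [i]; [a] and [b] guarantee that its complement is nonempty. *)
Lemma connected_degree_gt0 A (a b : 'I_n) : nonneg_mx A -> connected_mx A ->
  a != b -> forall i, 0 < \sum_j A i j.
Proof.
move=> A_ge0 Aconn ab i.
have [||_ [j [/= /eqP -> _ Aij]]] := Aconn (pred1 i).
- by exists i => /=.
- by have [->|] := eqVneq i a;
    [exists b; rewrite /= eq_sym|exists a; rewrite /= eq_sym].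
rewrite (bigD1 j) //= ltr_pwDl ?lt0r ?Aij ?A_ge0 //.
by apply: sumr_ge0.
Qed.

Lemma connected_neg A (t : 'rV[R]_n) i : nonneg_mx A -> connected_mx A ->
  t != 0 -> (forall i, t 0 i = 0 -> (t *m A) 0 i = 0) -> t 0 i <= 0 ->
  exists j, t 0 j < 0.
Proof.
move=> A_ge0 Aconn t0 tA ti; apply: contrapT => noneg.
suff : 0 < t 0 i by rewrite ltNge ti.
apply: (connected_pos A_ge0 Aconn) => // j.
by rewrite leNgt; apply/negP => tj; apply: noneg; exists j.
Qed.

End Spectral.

(** * Symmetrization of the equilibrium equation and conclusion *)

Theorem theorem4 (R : realType) (n : nat) (A : 'M[R]_n) (p : R)
    (psi : 'I_n -> R -> R) (K : set 'cV[R]_n) (xbar : 'cV[R]_n)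
    (A_nonneg : nonneg_mx A)
    (A_irreducible : irreducible_mx A)
    (A_symmetrizable : diag_symmetrizable A)
    (A_diag : null_diagonal A)
    (p_gt0 : 0 < p)
    (psi_odd : forall i, odd_fct (psi i))
    (psi_monotone : forall i, monotone_fct (psi i))
    (psi_saturated : forall i, saturated_fct (psi i))
    (psi_sigmoidal : forall i, sigmoidal_fct (psi i))
    (K_orthant : is_orthant K)
    (K_not_pos : K <> pos_orthant)
    (K_not_neg : K <> neg_orthant)
    (xbar_equilibrium : equilibrium (vector_field A p psi) xbar)
    (xbar_neq0 : xbar <> 0)
    (xbar_in_K : K xbar) :
  exists lambda : R,
    [/\ eigenvalue (p *: normalized_mx A) lambda,
        1 < lambda &
        lambda <> spectral_radius (p *: normalized_mx A)].
Proof.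
have [k [k1 KE]] := K_orthant; subst K.
have [a ka] : exists a, k a = - 1.
  apply: contrapT => noneg; apply: K_not_pos; congr orthant_of.
  by apply/funext => i; have [//|ki] := k1 i; case: noneg; exists i.
have [b kb] : exists b, k b = 1.
  apply: contrapT => nopos; apply: K_not_neg; congr orthant_of.
  by apply/funext => i; have [ki|//] := k1 i; case: nopos; exists i.
have ab : a != b by apply: contra_eq_neq kb => <-; rewrite ka; apply/eqP; lra.
have Aconn := irreducible_connected A_irreducible.
have e_gt0 := connected_degree_gt0 A_nonneg Aconn ab.
have xE i : xbar i 0 = p * (\sum_j A i j * psi j (xbar j 0)) / \sum_j A i j.
  have /(congr1 (mulmx (invmx (degree_mx A)))) := xbar_equilibrium.
  rewrite /vector_field.
  rewrite mulKmx ?degree_mx_unit // mulmx0 => /matrixP/(_ i 0).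
  rewrite 5!mxE => /eqP; rewrite addrC subr_eq0 => /eqP <-.
  rewrite -mulrA; congr (_ * _); rewrite mulr_suml; apply: eq_bigr => j _.
  by rewrite normalized_mxE // mxE mulrAC.
have [d [d_gt0 /matrixP dA]] := A_symmetrizable.
have {}dA i j : d 0 j * A j i = d 0 i * A i j.
  by have := dA i j; rewrite mxE !mul_diag_mx !mxE.
pose e i := \sum_j A i j.
pose f i := Num.sqrt (d 0 i * e i).
have f_gt0 i : 0 < f i by rewrite sqrtr_gt0 mulr_gt0 // e_gt0.
have f_neq0 i : f i != 0 by rewrite gt_eqF.
have fE i : f i ^+ 2 = d 0 i * e i.
  by rewrite sqr_sqrtr // ltW // mulr_gt0 // e_gt0.
(* This is [f i * H i j / f j], rewritten with [f i ^+ 2 = d 0 i * e i] so that symmetry follows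
   directly from [dA]. *)
pose B := \matrix_(i, j) (p * (d 0 i * A i j) / (f i * f j)).
have Bs : B^T = B.
  by apply/matrixP => i j; rewrite !mxE dA (mulrC (f j)).
have B_ge0 : nonneg_mx B.
  move=> i j; rewrite mxE divr_ge0 ?mulr_ge0 ?(ltW p_gt0) ?A_nonneg //;
  by rewrite ltW.
have Bconn : connected_mx B.
  move=> I I1 I2; have [i [j [Ii Ij Aij]]] := Aconn I I1 I2.
  exists i, j; split => //; rewrite mxE !mulf_neq0 ?invr_neq0 ?mulf_neq0 //;
  by rewrite gt_eqF.
pose t := \row_i (f i * psi i (xbar i 0)).
have tB i : (t *m B) 0 i = f i * xbar i 0.
  rewrite mxE xE.
  have -> : f i * (p * (\sum_j A i j * psi j (xbar j 0)) / \sum_j A i j) =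
    \sum_j (f i * p / e i * (A i j * psi j (xbar j 0))).
    by rewrite -mulr_sumr /e; ring.
  apply: eq_bigr => j _; rewrite !mxE dA.
  have ei : e i != 0 by rewrite gt_eqF // e_gt0.
  have -> : d 0 i = f i ^+ 2 / e i by rewrite fE mulfK.
  by field; rewrite ei !f_neq0.
(* Together with [tB], this shows that [t *m B] vanishes wherever [t] does, as [connected_neg]
   requires of [t] and of [- t]. *)
have t0 i : t 0 i = 0 -> xbar i 0 = 0.
  rewrite mxE => /eqP; rewrite mulf_eq0 (negPf (f_neq0 i)) /= => /eqP.
  exact: sigmoid_eq0.
have t_neq0 : t != 0.
  apply/eqP => /rowP tz; apply: xbar_neq0; apply/matrixP => i j.
  by rewrite (ord1 j) t0 ?tz !mxE.
have [j0 tj0] : exists j, t 0 j < 0.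
  apply: (@connected_neg _ _ B t a) => // [i ti|].
    by rewrite tB t0 ?mulr0.
  rewrite mxE pmulr_rle0 // sigmoid_le0 //.
  by have := xbar_in_K a; rewrite ka mulN1r oppr_ge0.
have NE (v : 'rV[R]_n) i : (- v) 0 i = - v 0 i by rewrite mxE.
have [i0] : exists j, (- t) 0 j < 0.
  apply: (@connected_neg _ _ B (- t) b) => //; first by rewrite oppr_eq0.
    move=> i; rewrite mulNmx !NE tB => /eqP; rewrite oppr_eq0 => /eqP /t0 ->.
    by rewrite mulr0 oppr0.
  rewrite NE oppr_le0 mxE pmulr_rge0 // sigmoid_ge0 //.
  by have := xbar_in_K b; rewrite kb mul1r.
rewrite NE oppr_lt0 => ti0.
have [|l1 [l2 [Bl1 Bl2 l2_gt1 l21]]] :=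
  two_eigenvalues_gt1 Bs B_ge0 Bconn ti0 tj0.
- move=> i ti; rewrite tB.
  have xi : xbar i 0 != 0.
    by apply: contra ti => /eqP xi; rewrite mxE xi odd_fct0 ?mulr0.
  rewrite mxE exprMn [ltRHS]mulrACA -(expr2 (f i)).
  rewrite (@ltr_pM2l _ (f i ^+ 2)) ?exprn_gt0 //.
  exact: sigmoid_sqr_lt.
have fH i j : f i * (p *: normalized_mx A) i j = B i j * f j.
  rewrite mxE normalized_mxE // mxE -/(e i).
  have ei : e i != 0 by rewrite gt_eqF // e_gt0.
  have -> : d 0 i = f i ^+ 2 / e i by rewrite fE mulfK.
  by field; rewrite ei !f_neq0.
(* The larger eigenvalue [l1] serves only to place [l2] strictly below the spectral radius. *)
exists l2; split => //; first exact: eigenvalue_diag_similar Bl2.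
apply/eqP; rewrite lt_eqF //; apply: lt_le_trans l21 _.
by apply: le_spectral_radius; exact: eigenvalue_diag_similar Bl1.
Qed.
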